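(* Let $d\ge1$ and $l\ge0$ be integers and let $p:\mathbb{N}\to[0,1]$ satisfy $$\lim_{n\to\infty}c_l(n)=+\infty,\qquad\text{where } c_l(n)=\frac{n^d(1+ld)}{d!}\,p(n)-\log n-l\log\log n.$$ Let $f$ be any function with $f(n)\gg n^{\frac{ld}{1+ld}}(\log n)^{-\frac{l}{1+ld}}$. Then asymptotically almost surely $\mu<f(n)$; that is, $\mathbb{P}[\mu<f(n)]\to1$ as $n\to\infty$.
   Context: $G^{d+1}(n,p)$ is the random $(d+1)$-uniform hypergraph on $n$ labelled vertices in which each of the $\binom{n}{d+1}$ potential edges ($(d+1)$-element vertex sets) is present with probability $p$, independently of the others. The random variable $\mu$ is the number of vertices outside the largest connected component of $G^{d+1}(n,p(n))$. For eventually positive functions, $f\gg g$ means $g(n)/f(n)\to0$. *)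

(* Defs.v *)
From HB Require Import structures.
From mathcomp Require Import all_boot all_order all_algebra.
From mathcomp Require Import all_classical all_reals all_analysis.
Set Implicit Arguments.
Unset Strict Implicit.
Unset Printing Implicit Defensive.
Import Order.TTheory GRing.Theory Num.Theory.
Import numFieldNormedType.Exports.
Local Open Scope ring_scope.

(* A hypergraph on the vertex set 'I_n is given by its set of edges. *)
Definition hypergraph (n : nat) := {set {set 'I_n}}.

Definition potential_edges (k n : nat) : hypergraph n :=
  [set e : {set 'I_n} | #|e| == k].

(* Both x = y and x != y are allowed; this does not affect [connect]. *)
Definition adjacent (n : nat) (H : hypergraph n) : rel 'I_n :=
  fun x y => [exists e in H, (x \in e) && (y \in e)].

Definition component (n : nat) (H : hypergraph n) (x : 'I_n) : {set 'I_n} :=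
  [set y | connect (adjacent H) x y].

Definition largest_component_size (n : nat) (H : hypergraph n) : nat :=
  \max_(x : 'I_n) #|component H x|.

Definition mu (n : nat) (H : hypergraph n) : nat :=
  (n - largest_component_size H)%N.

Lemma muE (n : nat) (H : hypergraph n) (x : 'I_n) :
  #|component H x| = largest_component_size H -> mu H = #|~: component H x|.
Proof. by move=> xmax; rewrite /mu -xmax [RHS]cardsCs finset.setCK card_ord. Qed.

(* Mass that G^k(n,p) gives to the k-uniform hypergraph H: the product
   Bernoulli(p) measure over the potential edges. *)
Definition random_hypergraph_mass (R : realType) (k n : nat) (p : R)
    (H : hypergraph n) : R :=
  \prod_(e in potential_edges k n) (if e \in H then p else 1 - p).

Definition random_hypergraph_prob (R : realType) (k n : nat) (p : R)
    (A : pred (hypergraph n)) : R :=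
  \sum_(H in powerset (potential_edges k n) | A H)
    random_hypergraph_mass k p H.

Lemma random_hypergraph_prob_total (R : realType) (k n : nat) (p : R) :
  random_hypergraph_prob k p (fun _ : hypergraph n => true) = 1.
Proof.
rewrite /random_hypergraph_prob /random_hypergraph_mass.
pose S := potential_edges k n.
have prod1 : \prod_(e : {set 'I_n})
    ((if e \in S then p else 0) + (if e \in S then 1 - p else 1)) = 1 :> R.
  by apply: big1 => e _; case: (e \in S); rewrite ?add0r // addrC subrK.
rewrite -[RHS]prod1 bigA_distr {prod1}.
rewrite [RHS](bigID (fun H : {set {set 'I_n}} => H \subset S)) /=.
rewrite [X in _ = _ + X]big1 ?addr0 => [|H /fintype.subsetPn[e eH eS]]; last first.
  by rewrite (bigD1 e) //= eH (negPf eS) mul0r.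
apply: eq_big => [H|H]; first by rewrite powersetE andbT.
rewrite powersetE andbT => /fintype.subsetP HS.
rewrite [RHS](bigID (mem S)) /= [X in _ * X]big1 ?mulr1.
  by apply: eq_bigr => e eS; rewrite eS.
by move=> e eS; rewrite (negPf eS); case: ifP => // /HS; rewrite (negPf eS).
Qed.

Local Open Scope classical_set_scope.

(* f >> g; meant for eventually positive f and g. *)
Definition much_greater (R : realType) (f g : nat -> R) : Prop :=
  (fun n => g n / f n) @ \oo --> (0 : R).

Definition c_ (R : realType) (d l : nat) (p : nat -> R) (n : nat) : R :=
  n%:R ^+ d * (1 + l * d)%:R / d`!%:R * p n
  - ln n%:R - l%:R * ln (ln n%:R).

(* Main.v *)
Require Import Defs.
From HB Require Import structures.
From mathcomp Require Import all_boot all_order all_algebra.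
From mathcomp Require Import all_classical all_reals all_analysis.
From mathcomp Require Import zify ring lra.
Import Order.TTheory GRing.Theory Num.Theory.
Import numFieldNormedType.Exports.

(** The proof is a first-moment estimate over vertex sets that no edge crosses.

    If the largest component has at least [n / 3] vertices, its complement is a
    union of components with [mu] vertices, hence at most [2n / 3] of them.
    Otherwise all components are small, and adding them one after another must
    produce a union of components whose size is between [n / 3] and [2n / 3]
    ([balanced_union_of_components]).  So [mu >= f n] forces a union of
    components [S] with [3 |S| <= 2 n] and either [|S| >= f n] or
    [3 |S| >= n].

    No edge may join such an [S] to its complement.  With [s = |S|], at least
    [s * 'C(n - s, d)] potential edges have exactly one vertex in [S]
    ([leq_card_crossing_edges]), so for each fixed [S] the probability is at
    most [(1 - p) ^ (s * 'C(n - s, d))].  As [(1 - p) <= exp (- p)] and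
    ['C(n, s) <= (e n / s) ^ s], the sets of size [s] contribute at most
    [(e (n / s) exp (- p 'C(n - s, d))) ^ s].  It suffices that the base of
    this power tends to [0] uniformly in the admissible [s]
    ([near_term_le]): the sum over [s] is then dominated by a geometric series.

    Write [L] for [ln n], [D] for [1 + l d] and [A] for [p n ^ d / d!].  By
    hypothesis [D A = L + l ln L + c] with [c] tending to infinity, and
    [p 'C(n - s, d)] is at least [A (1 - (s + d) / n) ^ d].
    - If [s <= n / L], then [s >= f n] eventually exceeds
      [n ^ (l d / D) L ^ (- l / D)], that is, [ln (n / s) <= (L + l ln L) / D];
      and the factor [(1 - (s + d) / n) ^ d] costs only a bounded amount, since
      the part of [A] that is needed is [O(L)].  What remains is [c / D] minus a
      constant ([small_set_exponent]).
    - If [s > n / L], then [ln (n / s) <= ln L], while the factor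
      [(1 - (s + d) / n) ^ d] is bounded below by [4 ^ (- d)], so that the
      exponent is of order [L] ([large_set_exponent]). *)

Local Open Scope ring_scope.

(** * Unions of components *)

Definition union_of_components {n : nat} (H : hypergraph n) (S : {set 'I_n}) :=
  [forall x in S, component H x \subset S].

Lemma connect_adjacent_sym (n : nat) (H : hypergraph n) :
  connect_sym (Defs.adjacent H).
Proof.
apply: sym_connect_sym => x y; apply: eq_existsb => e.
by rewrite [(x \in e) && _]andbC.
Qed.

Lemma union_of_componentsD (n : nat) (H : hypergraph n) (S : {set 'I_n})
    (x : 'I_n) :
  union_of_components H S ->
  union_of_components H (S :\: component H x).
Proof.
move=> /forall_inP US; apply/forall_inP => y; rewrite !inE => /andP[yNx yS].
apply/fintype.subsetP => z zy; rewrite inE.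
rewrite (fintype.subsetP (US y yS) z zy) andbT.
apply: contra yNx; rewrite !inE in zy *.
by move=> xz; apply: connect_trans xz _; rewrite connect_adjacent_sym.
Qed.

(** When every component has fewer than [n / 3] vertices, a smallest union of
    components with at least [n / 3] vertices does the job: removing one of its
    components brings it below [n / 3], so it has fewer than [2n / 3]. *)
Lemma balanced_union_of_components {n : nat} (H : hypergraph n) :
  exists S : {set 'I_n}, [/\ union_of_components H S,
    (3 * #|S| <= 2 * n)%N & #|S| = mu H \/ (n <= 3 * #|S|)%N].
Proof.
have UT : union_of_components H [set: 'I_n].
  by apply/forall_inP => x _; exact: finset.subsetT.
have [n0|n_gt0] := posnP n.
  exists finset.set0; split; first by apply/forall_inP => x; rewrite inE.
    by rewrite cards0 n0.
  by left; rewrite cards0 /mu; lia.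
have [|x xmax] := bigop.eq_bigmax (fun x => #|component H x|); first by rewrite card_ord.
have [big|small] := leqP n (3 * #|component H x|).
  exists (~: component H x); split; first by rewrite -finset.setTD union_of_componentsD.
    by have := cardsC (component H x); rewrite card_ord; lia.
  by left; rewrite (@muE _ _ x).
pose large S := union_of_components H S && (n <= 3 * #|S|)%N.
have largeT : large finset.setT.
  by rewrite /large UT cardsT card_ord; lia.
case: (arg_minnP (fun S : {set 'I_n} => #|S|) largeT) => S /andP[US nS] Smin.
exists S; split=> //; last by right.
have /card_gt0P[y yS] : (0 < #|S|)%N by lia.
have yx : (#|component H y| <= #|component H x|)%N.
  by rewrite -xmax; exact: bigop.leq_bigmax.
have yy : y \in S :&: component H y by rewrite !inE yS connect0.
have I0 : (0 < #|S :&: component H y|)%N by apply/card_gt0P; exists y.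
have := cardsID (component H y) S.
have : (#|S :&: component H y| <= #|component H y|)%N.
  by rewrite subset_leq_card// finset.subsetIr.
case: (leqP n (3 * #|S :\: component H y|)) => [h|]; last by lia.
have := Smin (S :\: component H y); rewrite /large union_of_componentsD// h => /(_ isT).
lia.
Qed.

(** * Crossing edges *)

Definition crossing_edges (k : nat) {n : nat} (S : {set 'I_n}) : hypergraph n :=
  [set e in potential_edges k n |
    (e :&: S != finset.set0) && ~~ (e \subset S)].

Lemma union_of_components_avoids (k n : nat) (H : hypergraph n)
    (S : {set 'I_n}) :
  union_of_components H S -> [disjoint H & crossing_edges k S].
Proof.
move=> /forall_inP US; apply/pred0P => e /=; apply/negbTE/negP => /andP[eH].
rewrite !inE => /andP[_ /andP[/set0Pn[x]]]; rewrite inE => /andP[xe xS] /negP; apply.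
apply/fintype.subsetP => y ye; apply: (fintype.subsetP (US x xS)).
by rewrite inE connect1//; apply/existsP; exists e; rewrite eH xe ye.
Qed.

(** Only the edges [x |: T] with [x] in [S] and the [d] vertices of [T] outside
    [S] are counted; [x] and [T] are recovered as the traces of the edge on [S]
    and on its complement. *)
Lemma leq_card_crossing_edges (d n : nat) (S : {set 'I_n}) : (0 < d)%N ->
  (#|S| * 'C(n - #|S|, d) <= #|crossing_edges d.+1 S|)%N.
Proof.
move=> d_gt0.
pose D := [set T : {set 'I_n} | (T \subset ~: S) && (#|T| == d)].
have cD : #|D| = 'C(n - #|S|, d).
  by rewrite cards_draws; congr 'C(_, _); have := cardsC S; rewrite card_ord; lia.
have TS (T : {set 'I_n}) z : T \in D -> z \in T -> z \notin S.
  by rewrite inE => /andP[/fintype.subsetP h _] /h; rewrite inE.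
pose h (u : 'I_n * {set 'I_n}) := u.1 |: u.2.
have hS (x : 'I_n) T : x \in S -> T \in D -> h (x, T) :&: S = [set x]%SET.
  move=> xS TD; apply/setP => z; rewrite !inE /=.
  case: eqP => [->|_] /=; first by rewrite xS.
  by apply/negP => /andP[/(TS _ _ TD)/negP].
have hNS (x : 'I_n) T : x \in S -> T \in D -> h (x, T) :\: S = T.
  move=> xS TD; apply/setP => z; rewrite !inE /=.
  case: eqP => [->|_] /=.
    by rewrite xS; apply/esym/negP => /(TS _ _ TD); rewrite xS.
  by case: (boolP (z \in T)); rewrite ?andbF// andbT => /(TS _ _ TD).
rewrite -cD -cardsX -(card_in_imset (f := h)).
  apply: subset_leq_card; apply/fintype.subsetP => _ /imsetP[[x T] /setXP[/= xS TD] ->].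
  have xT : x \notin T by apply/negP => /(TS _ _ TD); rewrite xS.
  move: (TD); rewrite inE => /andP[_ /eqP cT].
  rewrite !inE cardsU1 xT cT eqxx /= hS//; apply/andP; split.
    by apply/set0Pn; exists x; rewrite inE.
  rewrite -finset.setD_eq0 hNS// -card_gt0 cT//.
move=> [x T] [y U] /setXP[/= xS TD] /setXP[/= yS UD] e.
have := hS _ _ xS TD; rewrite e hS// => /finset.set1_inj ->.
by have := hNS _ _ xS TD; rewrite e hNS// => ->.
Qed.

(** * Probabilities *)

(** Expanding a product over all vertex sets [e] of two-term sums, one term for
    [e] present and one for [e] absent, yields a sum over all hypergraphs.
    Giving presence the weight 0 outside the potential edges and on [X] keeps
    exactly the hypergraphs of the event, and the factors over [X] are those
    that differ from 1. *)
Lemma random_hypergraph_prob_avoids (R : realType) (k n : nat) (p : R)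
    (X : hypergraph n) : X \subset potential_edges k n ->
  random_hypergraph_prob k p (fun H : hypergraph n => [disjoint H & X]) =
  (1 - p) ^+ #|X|.
Proof.
move=> /fintype.subsetP XE.
rewrite /random_hypergraph_prob /random_hypergraph_mass.
pose E := potential_edges k n.
have -> : (1 - p) ^+ #|X| = \prod_(e : {set 'I_n})
    ((if e \in E :\: X then p else 0) + (if e \in E then 1 - p else 1)).
  rewrite -prodr_const [RHS](bigID (mem X)) /= [X in _ * X]big1 ?mulr1.
    by apply: eq_bigr => e eX; rewrite inE eX add0r XE.
  by move=> e eX; rewrite inE eX /=; case: ifP; rewrite ?add0r// addrC subrK.
rewrite bigA_distr.
rewrite [RHS](bigID (fun H : {set {set 'I_n}} => H \subset E :\: X)) /=.
rewrite [X in _ = _ + X]big1 ?addr0 => [|H /fintype.subsetPn[e eH eS]]; last first.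
  by rewrite (bigD1 e) //= eH (negPf eS) mul0r.
apply: eq_big => [H|H]; first by rewrite powersetE finset.subsetD.
rewrite powersetE => /andP[/fintype.subsetP HE HX].
rewrite [RHS](bigID (mem E)) /= [X in _ * X]big1 ?mulr1.
  apply: eq_bigr => e eE; rewrite inE eE; case: (boolP (e \in H)) => // eH.
  by rewrite andbT (disjointFr HX eH).
by move=> e eE; rewrite (negPf eE); case: ifP => // /HE; rewrite (negPf eE).
Qed.

Lemma random_hypergraph_mass_ge0 (R : realType) (k n : nat) (p : R)
    (H : hypergraph n) : 0 <= p <= 1 -> 0 <= random_hypergraph_mass k p H.
Proof.
by move=> /andP[p0 p1]; apply: prodr_ge0 => e _; case: ifP; rewrite ?subr_ge0.
Qed.

Lemma random_hypergraph_prob_predC (R : realType) (k n : nat) (p : R)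
    (A : pred (hypergraph n)) :
  random_hypergraph_prob k p A =
  1 - random_hypergraph_prob k p (fun H => ~~ A H).
Proof.
apply/eqP; rewrite -subr_eq opprK; apply/eqP.
rewrite -[RHS](random_hypergraph_prob_total k n p) /random_hypergraph_prob.
rewrite [RHS](bigID A) /=.
by congr (_ + _); apply: eq_bigl => H; rewrite andbT.
Qed.

Lemma random_hypergraph_prob_union (R : realType) (k n : nat) (p : R)
    (I : finType) (P : pred I) (A : pred (hypergraph n))
    (B : I -> pred (hypergraph n)) : 0 <= p <= 1 ->
  (forall H, A H -> exists2 i, P i & B i H) ->
  random_hypergraph_prob k p A <=
  \sum_(i | P i) random_hypergraph_prob k p (B i).
Proof.
move=> p01 AB; rewrite /random_hypergraph_prob big_mkcondr/=.
under [leRHS]eq_bigr do rewrite big_mkcondr/=.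
rewrite exchange_big/=; apply: ler_sum => H _.
case: ifP => [/AB[i Pi BiH]|_]; last first.
  by apply: sumr_ge0 => i _; case: ifP => // _; exact: random_hypergraph_mass_ge0.
rewrite (bigD1 i)//= BiH lerDl; apply: sumr_ge0 => j _.
by case: ifP => // _; exact: random_hypergraph_mass_ge0.
Qed.

(** A large [mu] forces a balanced union of components, so the union bound over
    vertex sets applies; the sets of equal size [s] all get the same bound. *)
Lemma random_hypergraph_prob_mu_ge (R : realType) (d n : nat) (p x : R) :
  (0 < d)%N -> (0 < n)%N -> 0 <= p <= 1 -> 0 < x ->
  random_hypergraph_prob d.+1 p (fun H : hypergraph n => x <= (mu H)%:R) <=
  \sum_(s < n.+1 |
      [&& (0 < s)%N, (3 * s <= 2 * n)%N & (x <= s%:R) || (n <= 3 * s)%N])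
    'C(n, s)%:R * (1 - p) ^+ (s * 'C(n - s, d)).
Proof.
move=> d_gt0 n_gt0 p01 x_gt0.
pose ok s := [&& (0 < s)%N, (3 * s <= 2 * n)%N & (x <= s%:R) || (n <= 3 * s)%N].
pose B (S : {set 'I_n}) (H : hypergraph n) := [disjoint H & crossing_edges d.+1 S].
have cardS (S : {set 'I_n}) : (#|S| < n.+1)%N.
  by rewrite ltnS -[leqRHS]card_ord max_card.
apply: (@le_trans _ _ (\sum_(S : {set 'I_n} | ok #|S|)
    random_hypergraph_prob d.+1 p (B S))).
  apply: random_hypergraph_prob_union => // H xH.
  have [S [US S_le S_ge]] := balanced_union_of_components H.
  exists S; last exact: union_of_components_avoids.
  rewrite /ok S_le /=; case: S_ge => [S_mu|S_ge].
    by rewrite S_mu xH andbT -(ltr_nat R) (lt_le_trans x_gt0).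
  by have := leq_trans n_gt0 S_ge; rewrite S_ge orbT andbT muln_gt0.
rewrite (partition_big (fun S => Ordinal (cardS S)) (fun s : 'I_n.+1 => ok s)) //=.
apply: ler_sum => s oks.
have -> : 'C(n, s) = #|[set S : {set 'I_n} | #|S| == s]|.
  by rewrite card_draws card_ord.
rewrite mulr_natl -sumr_const.
under [leRHS]eq_bigl do rewrite inE.
rewrite (eq_bigl (fun S : {set 'I_n} => #|S| == s)); last first.
  move=> S; rewrite -val_eqE /=; case: eqP => [->|]; rewrite ?andbT ?andbF//.
apply: ler_sum => S /eqP Ss.
rewrite random_hypergraph_prob_avoids; last first.
  by apply/fintype.subsetP => e; rewrite inE => /andP[].
have /andP[p0 p1] := p01.
apply: ler_wiXn2l; rewrite ?subr_ge0 ?gerBl//.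
by rewrite -Ss leq_card_crossing_edges.
Qed.

(** * Elementary estimates *)

(** With [x = s / n], one term of the binomial expansion of [(1 + x) ^ n] gives
    ['C(n, s) * x ^ s <= (1 + x) ^ n <= exp (n x) = exp s]. *)
Lemma bin_le_expR (R : realType) (n s : nat) : (0 < s)%N -> (0 < n)%N ->
  'C(n, s)%:R <= (expR 1 * (n%:R / s%:R)) ^+ s :> R.
Proof.
move=> s_gt0 n_gt0.
have [lt_ns|le_sn] := ltnP n s.
  by rewrite bin_small// exprn_ge0// mulr_ge0 ?expR_ge0// divr_ge0.
have s0 : 0 < s%:R :> R by rewrite ltr0n.
have n0 : 0 < n%:R :> R by rewrite ltr0n.
pose x : R := s%:R / n%:R.
have x0 : 0 < x by rewrite divr_gt0.
have -> : n%:R / s%:R = x^-1 :> R by rewrite invf_div.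
rewrite exprMn exprVn -expRM_natl mulr1 ler_pdivlMr ?exprn_gt0//.
apply: (@le_trans _ _ ((1 + x) ^+ n)).
  rewrite exprDn (bigD1 (inord s)) //= inordK ?ltnS// expr1n mul1r mulr_natl lerDl.
  apply: sumr_ge0 => i _; rewrite mulrn_wge0// mulr_ge0 ?exprn_ge0 ?ltW//.
have -> : s%:R = n%:R * x by rewrite /x; field; rewrite gt_eqF.
by rewrite expRM_natl lerXn2r ?nnegrE ?expR_ge0 ?expR_ge1Dx// addr_ge0 ?ltW.
Qed.

Lemma sum_le_geometric (R : realFieldType) (n : nat) (P : pred nat) (q : R)
    (F : nat -> R) : 0 < q -> q <= 1 / 2 ->
  (forall s, (s < n)%N -> P s -> (0 < s)%N /\ F s <= q ^+ s) ->
  \sum_(s < n | P s) F s <= 2 * q.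
Proof.
move=> q0 q2 HF.
apply: (@le_trans _ _ (\sum_(s < n) q * q ^+ s.-1 *+ (0 < s)%N)).
  rewrite big_mkcond; apply: ler_sum => s _; case: ifP => [/HF[]//|_].
    by move=> s0 h; rewrite s0 -exprS prednK.
  by rewrite mulrn_wge0// mulr_ge0 ?exprn_ge0 ?ltW.
case: n {HF} => [|n]; first by rewrite big_ord0 mulr_ge0 ?ltW.
rewrite big_ord_recl /= mulr0n add0r -mulr_sumr mulrC ler_wpM2r ?(ltW q0)//.
have := subrX1 q n.
have : 0 <= q ^+ n by rewrite exprn_ge0 ?ltW.
rewrite -[X in _ -> _ -> X <= _]/(\sum_(i < n) q ^+ i).
set G := \sum_(i < n) _; nra.
Qed.

Lemma expn_le_ffact (m d : nat) : ((m - d) ^ d <= m ^_ d)%N.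
Proof.
elim: d m => [|d IH] m //.
rewrite ffactnS expnS leq_mul ?leq_subr//.
by apply: leq_trans (IH m.-1); case: d {IH} => // d; rewrite leq_exp2r//; lia.
Qed.

Lemma bernoulli_ineq (R : realFieldType) (d : nat) (x : R) :
  0 <= x <= 1 -> 1 - d%:R * x <= (1 - x) ^+ d.
Proof.
move=> /andP[x0 x1]; elim: d => [|d IH]; first by rewrite mul0r subr0.
rewrite exprS; have : 0 <= (1 - x) ^+ d <= 1.
  by rewrite exprn_ge0 ?exprn_ile1 ?subr_ge0 ?gerBl.
rewrite -natr1; have : 0 <= d%:R :> R by [].
by set y := _ ^+ d in IH *; nra.
Qed.

(** [n ^ d / d!] is the asymptotic value of ['C(n, d)]; the other factor is the
    loss due to leaving out [s] vertices and to replacing the falling factorial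
    by a power. *)
Lemma bin_ge_density (R : realFieldType) (d n s : nat) :
  (0 < n)%N -> (s + d <= n)%N ->
  n%:R ^+ d / d`!%:R * (1 - (s + d)%:R / n%:R) ^+ d <= 'C(n - s, d)%:R :> R.
Proof.
move=> n_gt0 sdn.
have n0 : (n%:R : R) != 0 by rewrite pnatr_eq0 -lt0n.
have d0 : 0 < d`!%:R :> R by rewrite ltr0n fact_gt0.
rewrite mulrAC ler_pdivrMr// -exprMn -natrM bin_ffact.
have -> : n%:R * (1 - (s + d)%:R / n%:R) = (n - s - d)%:R :> R.
  by rewrite -subnDA natrB//; field.
by rewrite -natrX ler_nat expn_le_ffact.
Qed.

(** * The exponent for small and for large sets *)

(** Here [L] stands for [ln n] and [B] for the bound on [ln (n / s)].  There is
    no upper bound on [A], so it is first lowered to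
    [B + (M + 1 + d * (2 * (l + 2)))], which is at most [(l + 2) * L]: then by
    the Bernoulli inequality the factor [(1 - (s + d) / n) ^ d] costs at most
    [d * (l + 2) * L * (s + d) / n], and [L * (s + d) <= 2 * n]. *)
Lemma small_set_exponent (R : realFieldType) (d l n s : nat) (A B L M : R) :
  (0 < n)%N -> (s + d <= n)%N -> s%:R * L <= n%:R -> d%:R * L <= n%:R ->
  0 <= M -> 0 <= B -> B <= (l%:R + 1) * L ->
  M + 1 + d%:R * (2 * (l%:R + 2)) <= L ->
  B + (M + 1 + d%:R * (2 * (l%:R + 2))) <= A ->
  B + (M + 1) <= A * (1 - (s + d)%:R / n%:R) ^+ d.
Proof.
move=> n_gt0 sdn sL dL M0 B0 BL KL BA.
have n0 : 0 < (n%:R : R) by rewrite ltr0n.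
set K := d%:R * _ in KL BA; set x := (s + d)%:R / n%:R.
have x01 : 0 <= x <= 1.
  by rewrite divr_ge0//= ler_pdivrMr// mul1r ler_nat.
have [/andP[x0 x1] bern] := (x01, bernoulli_ineq R d x x01).
have K0 : 0 <= K by rewrite mulr_ge0// mulr_ge0// addr_ge0.
have xL : x * L <= 2.
  rewrite mulrAC ler_pdivrMr// natrD mulrDl; lra.
have L0 : 0 <= L by lra.
have l0 : 0 <= l%:R :> R by [].
have A'L : B + (M + 1 + K) <= (l%:R + 2) * L by lra.
have A'x : (B + (M + 1 + K)) * x <= 2 * (l%:R + 2).
  apply: (@le_trans _ _ ((l%:R + 2) * L * x)); first exact: ler_wpM2r.
  by rewrite -mulrA [L * x]mulrC [leRHS]mulrC ler_wpM2l// addr_ge0.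
have A'dx : (B + (M + 1 + K)) * (d%:R * x) <= K.
  by rewrite mulrCA ler_wpM2l.
apply: (@le_trans _ _ ((B + (M + 1 + K)) * (1 - x) ^+ d)); last first.
  by rewrite ler_wpM2r// exprn_ge0// subr_ge0.
apply: (@le_trans _ _ ((B + (M + 1 + K)) * (1 - d%:R * x))); last first.
  by rewrite ler_wpM2l//; lra.
lra.
Qed.

(** The base is at least [1 - 2 / 3 - 1 / 12 = 1 / 4]. *)
Lemma large_set_exponent (R : realFieldType) (d n s : nat) (A : R) :
  (0 < n)%N -> (3 * s <= 2 * n)%N -> (12 * d <= n)%N -> 0 <= A ->
  A * (1 / 4) ^+ d <= A * (1 - (s + d)%:R / n%:R) ^+ d.
Proof.
move=> n_gt0 sn dn A0; rewrite ler_wpM2l//.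
have n0 : 0 < (n%:R : R) by rewrite ltr0n.
have h : 1 / 4 <= 1 - (s + d)%:R / n%:R :> R.
  rewrite lerBrDr -lerBrDl ler_pdivrMr//.
  have : (4 * (s + d))%:R <= (3 * n)%:R :> R by rewrite ler_nat; lia.
  by rewrite !natrM; lra.
by apply: lerXn2r; rewrite // nnegrE ?(le_trans _ h).
Qed.

(** * Growth of the logarithm *)

Local Open Scope classical_set_scope.

(** Apply [ln y <= y - 1] to [y = a * x / 2]; the spare half of [a * x] absorbs
    the constants. *)
Lemma near_ln_le_linear (R : realType) (a b : R) : 0 < a ->
  \forall x \near +oo, ln x + b <= a * x.
Proof.
move=> a0; have a2 : 0 < a / 2 by rewrite divr_gt0.
near=> x.
have x0 : 0 < x by near: x; exact: nbhs_pinfty_gt.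
have h1 : ln (a / 2) + ln x <= a / 2 * x.
  rewrite -lnM ?posrE//.
  have := @le_ln1Dx R (a / 2 * x - 1); rewrite subrKC => h.
  apply: le_trans (h _) _; last by rewrite gerBl.
  by rewrite ltrBrDr addNr mulr_gt0.
have : (b - ln (a / 2)) / (a / 2) <= x.
  by near: x; apply: nbhs_pinfty_ge; exact: num_real.
rewrite ler_pdivrMr// => h2; lra.
Unshelve. all: by end_near. Qed.

Lemma cvg_ln_natr (R : realType) : (fun n => ln n%:R : R) @ \oo --> +oo.
Proof.
apply/cvgryPge => A; near=> n.
have h : expR A <= n%:R by near: n; exact: nbhs_infty_ger.
by rewrite -[A]expRK ler_ln ?posrE ?expR_gt0// (lt_le_trans (expR_gt0 A)).
Unshelve. all: by end_near. Qed.

(** The threshold in the hypothesis on [f] is exactly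
    [n / (n * (ln n) ^ l) ^ (1 / (1 + l * d))], that is, the size at which the
    entropy [ln (n / s)] of choosing a set matches the main term of the
    exponent. *)
Lemma ln_ratio_le (R : realType) (d l n s : nat) :
  (0 < n)%N -> (0 < s)%N -> 0 < ln n%:R :> R ->
  n%:R `^ ((l * d)%:R / (1 + l * d)%:R)
     * ln n%:R `^ (- (l%:R / (1 + l * d)%:R)) <= s%:R :> R ->
  ln (n%:R / s%:R) <= (ln n%:R + l%:R * ln (ln n%:R)) / (1 + l * d)%:R :> R.
Proof.
move=> n_gt0 s_gt0 L0 gs.
have n0 : 0 < (n%:R : R) by rewrite ltr0n.
have s0 : 0 < (s%:R : R) by rewrite ltr0n.
have D0 : 0 < ((1 + l * d)%:R : R) by rewrite ltr0n.
rewrite ln_div ?posrE//.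
have {}gs : ln (n%:R `^ ((l * d)%:R / (1 + l * d)%:R)
     * ln n%:R `^ (- (l%:R / (1 + l * d)%:R))) <= ln (s%:R : R).
  by rewrite ler_ln ?posrE ?mulr_gt0 ?powR_gt0.
rewrite lnM ?posrE ?powR_gt0// !ln_powR in gs.
rewrite -subr_ge0; rewrite -subr_ge0 in gs; apply: le_trans gs _.
rewrite le_eqVlt; apply/orP; left; apply/eqP; rewrite natrD.
by field; rewrite -natrM nat1r pnatr_eq0.
Qed.

(** * The limit *)

(** The quantity bounded here is the base of the power that controls all sets
    of size [s]; the point is that the range of [n] does not depend on [s]. *)
Lemma near_term_le (R : realType) (d l : nat) (p f : nat -> R) (q : R)
  (p01 : forall n, 0 <= p n <= 1)
  (c_oo : c_ d l p @ \oo --> +oo)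
  (f_pos : \forall n \near \oo, 0 < f n)
  (f_gg : much_greater f (fun n =>
     n%:R `^ ((l * d)%:R / (1 + l * d)%:R)
     * ln n%:R `^ (- (l%:R / (1 + l * d)%:R)))) :
  0 < q -> q <= 1 ->
  \forall n \near \oo, forall s : nat, (0 < s)%N -> (3 * s <= 2 * n)%N ->
    (f n <= s%:R) || (n <= 3 * s)%N ->
    expR 1 * (n%:R / s%:R) * expR (- (p n * 'C(n - s, d)%:R)) <= q.
Proof.
move=> q0 q1.
pose M := - ln q; have M0 : 0 <= M by rewrite oppr_ge0 ln_le0.
pose D : R := (1 + l * d)%:R.
have D0 : 0 < D by rewrite ltr0n.
have D1 : 1 <= D by rewrite ler1n.
(* [B + m] is the part of [A] that the estimate for small sets keeps. *)
pose m := M + 1 + d%:R * (2 * (l%:R + 2)).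
have m0 : 0 <= m by rewrite !addr_ge0 ?mulr_ge0 ?addr_ge0.
near=> n => s s_gt0 sn fs.
have n_gt0 : (0 < n)%N by near: n; exact: nbhs_infty_gt.
have dn : (12 * d <= n)%N by near: n; exact: nbhs_infty_ge.
have sdn : (s + d <= n)%N by lia.
have n0 : 0 < (n%:R : R) by rewrite ltr0n.
have s0 : 0 < (s%:R : R) by rewrite ltr0n.
set L : R := ln n%:R.
have L4 : 4 <= L by rewrite /L; near: n; move/cvgryPge: (cvg_ln_natr R); exact.
have mL : m <= L by rewrite /L; near: n; move/cvgryPge: (cvg_ln_natr R); exact.
have LL0 : 0 <= ln L by rewrite ln_ge0//; lra.
have LLL : ln L + 0 <= 1 * L.
  rewrite /L; near: n; apply: (cvg_ln_natr R (fun x => ln x + 0 <= 1 * x)).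
  exact: near_ln_le_linear.
have LLa : ln L + (M + 1) <= D^-1 * (1 / 4) ^+ d * L.
  rewrite /L; near: n; apply: (cvg_ln_natr R
    (fun x => ln x + (M + 1) <= D^-1 * (1 / 4) ^+ d * x)).
  by apply: near_ln_le_linear; rewrite mulr_gt0 ?invr_gt0 ?exprn_gt0.
have dL : d%:R * L <= n%:R.
  have : L + 0 <= (d.+1%:R)^-1 * n%:R.
    rewrite /L; near: n.
    apply: (@cvgr_idn R (fun x => ln x + 0 <= (d.+1%:R)^-1 * x)).
    by apply: near_ln_le_linear; rewrite invr_gt0.
  rewrite addr0 mulrC ler_pdivlMr// -natr1 mulrDr mulr1 mulrC; lra.
have cm : D * m <= c_ d l p n.
  by near: n; move/cvgryPge: c_oo; exact.
pose A : R := p n * (n%:R ^+ d / d`!%:R).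
pose B : R := (L + l%:R * ln L) / D.
have BmA : B + m <= A.
  rewrite /B -lerBrDr ler_pdivrMr// mulrBl.
  have -> : A * D = n%:R ^+ d * D / d`!%:R * p n by rewrite /A; ring.
  by move: cm; rewrite /c_ -/D -/L; lra.
have lL0 : 0 <= l%:R * ln L by rewrite mulr_ge0.
have LB : L / D <= B by rewrite ler_wpM2r ?invr_ge0 ?(ltW D0)// lerDl.
have B0 : 0 <= B by apply: le_trans LB; rewrite divr_ge0//; lra.
have BL : B <= (l%:R + 1) * L.
  rewrite ler_pdivrMr//; apply: (@le_trans _ _ ((l%:R + 1) * L)).
    rewrite mulrDl mul1r addrC lerD2r ler_wpM2l//; lra.
  by rewrite ler_peMr// mulr_ge0 ?addr_ge0//; lra.
have [p0 p1] := andP (p01 n).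
have pC : A * (1 - (s + d)%:R / n%:R) ^+ d <= p n * 'C(n - s, d)%:R.
  by rewrite /A -mulrA ler_wpM2l// bin_ge_density.
suff key : ln (n%:R / s%:R) + (M + 1) <= A * (1 - (s + d)%:R / n%:R) ^+ d.
  have -> : n%:R / s%:R = expR (ln (n%:R / s%:R)) :> R.
    by rewrite lnK// posrE divr_gt0.
  rewrite -!expRD -[leRHS]lnK ?posrE// ler_expR.
  by move: key pC; rewrite /M; lra.
(* [n / L] separates the sets that are so small that leaving out their
   vertices is harmless from those with so few choices that a constant
   fraction of the exponent is enough. *)
have [sL|nL] := lerP (s%:R * L) n%:R.
  apply: (@le_trans _ _ (B + (M + 1))); last exact: (small_set_exponent _ _ l n s A B L).
  rewrite lerD2r ln_ratio_le//; first by rewrite -/L; lra.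
  case/orP: fs => [fs|ns].
    apply: le_trans fs; have f0 : 0 < f n by near: n.
    rewrite -[leRHS]mul1r -ler_pdivrMr//; apply: le_trans (ler_norm _) _.
    by apply: ltW; near: n; apply: (cvgr0_norm_lt _ f_gg).
  (* [s <= n / L] with [L >= 4] excludes [n <= 3 * s]. *)
  exfalso; move: ns; rewrite -(ler_nat R) natrM => ns.
  by nra.
apply: (@le_trans _ _ (A * (1 / 4) ^+ d)); last first.
  by apply: large_set_exponent => //; lra.
apply: (@le_trans _ _ (ln L + (M + 1))).
  rewrite lerD2r ler_ln ?posrE ?divr_gt0//; last by lra.
  by rewrite ler_pdivrMr// mulrC ltW.
apply: le_trans LLa _; rewrite mulrAC; apply: ler_wpM2r.
  by rewrite exprn_ge0// divr_ge0.
by rewrite mulrC; lra.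
Unshelve. all: by end_near. Qed.

Theorem theorem6p8 (R : realType) (d l : nat) (p f : nat -> R)
  (d_ge1 : (1 <= d)%N)
  (p01 : forall n, 0 <= p n <= 1)
  (c_oo : c_ d l p @ \oo --> +oo)
  (f_pos : \forall n \near \oo, 0 < f n)
  (f_gg : much_greater f (fun n =>
     n%:R `^ ((l * d)%:R / (1 + l * d)%:R)
     * ln n%:R `^ (- (l%:R / (1 + l * d)%:R)))) :
  (fun n => random_hypergraph_prob d.+1 (p n)
              (fun H : hypergraph n => (mu H)%:R < f n)) @ \oo --> (1 : R).
Proof.
apply/cvgrPdist_le => eps eps0.
pose q := Num.min (1 / 2) (eps / 2).
have q0 : 0 < q by rewrite lt_min !divr_gt0.
have q2 : q <= 1 / 2 by rewrite ge_min lexx.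
have qe : 2 * q <= eps by rewrite mulrC -ler_pdivlMr// ge_min lexx orbT.
have q1 : q <= 1 by lra.
near=> n.
have n_gt0 : (0 < n)%N by near: n; exact: nbhs_infty_gt.
have f0 : 0 < f n by near: n.
have small : forall s : nat, (0 < s)%N -> (3 * s <= 2 * n)%N ->
    (f n <= s%:R) || (n <= 3 * s)%N ->
    expR 1 * (n%:R / s%:R) * expR (- (p n * 'C(n - s, d)%:R)) <= q.
  by near: n; exact: near_term_le c_oo f_pos f_gg q0 q1.
rewrite random_hypergraph_prob_predC opprB addrC subrK.
rewrite ger0_norm; last first.
  by apply: sumr_ge0 => H _; exact: random_hypergraph_mass_ge0.
have -> : random_hypergraph_prob d.+1 (p n)
      (fun H : hypergraph n => ~~ ((mu H)%:R < f n)) =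
    random_hypergraph_prob d.+1 (p n)
      (fun H : hypergraph n => f n <= (mu H)%:R).
  by apply: eq_bigl => H; rewrite -leNgt.
apply: (le_trans (random_hypergraph_prob_mu_ge _ _ _ _ _ d_ge1 n_gt0 (p01 n) f0)).
apply: le_trans qe.
apply: (sum_le_geometric _ _ (fun s => [&& (0 < s)%N, (3 * s <= 2 * n)%N &
  (f n <= s%:R) || (n <= 3 * s)%N])
  _ (fun s => 'C(n, s)%:R * (1 - p n) ^+ (s * 'C(n - s, d)))) => // s _.
move=> /and3P[s_gt0 sn fs]; split=> //.
apply: (@le_trans _ _ ((expR 1 * (n%:R / s%:R) *
    expR (- (p n * 'C(n - s, d)%:R))) ^+ s)).
  have [p0 p1] := andP (p01 n).
  rewrite exprMn mulnC exprM ler_pM ?exprn_ge0 ?subr_ge0 ?bin_le_expR//.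
  rewrite lerXn2r ?nnegrE ?exprn_ge0 ?subr_ge0 ?expR_ge0//.
  rewrite -mulNr mulrC expRM_natl lerXn2r ?nnegrE ?subr_ge0 ?expR_ge0//.
  exact: expR_ge1Dx.
by apply: lerXn2r; rewrite ?nnegrE ?(ltW q0) ?small.
Unshelve. all: by end_near. Qed.
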